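(* Let $(Q,\cdot)$ be a quasigroup. Then $Q$ is trimedial if and only if it satisfies the identity $$\bigl[(x\cdot y)\cdot(u\cdot u)\bigr]\cdot\bigl[\bigl(w\cdot (w\cdot w)\bigr)\cdot(z\cdot v)\bigr] = \bigl[(x\cdot u)\cdot(y\cdot u)\bigr]\cdot\bigl[(w\cdot z)\cdot\bigl((w\cdot w)\cdot v\bigr)\bigr]$$ for all $x,y,u,w,z,v\in Q$.
   Context: A groupoid is a set $G$ with a binary operation $\cdot$ (no further axioms assumed). A quasigroup is a groupoid $(Q,\cdot)$ such that for all $a,b\in Q$ the equations $a\cdot x=b$ and $y\cdot a=b$ have unique solutions $x,y\in Q$. A groupoid is medial if it satisfies the identity $(w\cdot x)\cdot(y\cdot z)=(w\cdot y)\cdot(x\cdot z)$ for all $w,x,y,z$. A groupoid is trimedial if every subgroupoid (subset closed under $\cdot$) generated by $3$ elements is medial. *)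

(* Defs.v *)
From Stdlib Require Import Ensembles.

Set Implicit Arguments.

Section Groupoids.

Variables (Q : Type) (op : Q -> Q -> Q).

Local Infix "·" := op (at level 40, left associativity).

Definition quasigroup : Prop :=
  forall a b : Q, (exists! x : Q, a · x = b) /\ (exists! y : Q, y · a = b).

Definition subgroupoid (H : Ensemble Q) : Prop :=
  forall x y : Q, In Q H x -> In Q H y -> In Q H (x · y).

(* The intersection of all subgroupoids containing S. *)
Definition generated (S : Ensemble Q) : Ensemble Q :=
  fun x => forall H : Ensemble Q,
    subgroupoid H -> Included Q S H -> In Q H x.

(* Mediality of a subgroupoid H under the restricted operation; since that
   operation is inherited, the identity can be stated in Q itself. *)
Definition medial_on (H : Ensemble Q) : Prop :=
  forall w x y z : Q, In Q H w -> In Q H x -> In Q H y -> In Q H z ->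
    (w · x) · (y · z) = (w · y) · (x · z).

(* The three generators are not required to be distinct. *)
Definition trimedial : Prop :=
  forall a b c : Q, medial_on (generated (Triple Q a b c)).

End Groupoids.

(* Main.v *)
Require Import Defs.
From Stdlib Require Import Ensembles IndefiniteDescription.

(** The identity is an equality of two products in which the left factors share
    no variable with the right ones, and the left factors agree for [y = u], so it splits into
      (xy)(uu) = (xu)(yu)   and   (w.ww)(zv) = (wz)(ww.v).
    Call a map [b] central if [x (b y)] is a function of the product [x y].
    Comparing the translation autotopisms of the two identities
    shows that [L_u^-1 L_uu] is central for every [u]; this
    yields the remaining semimedial law ww.xy = wx.wy and, after that, that
    [uu] is the image of [u] under a central map.  Put
    M(w,x,y,z) :<-> wx.yz = wy.xz.  A central map may be applied to any argument
    of M.  Multiplying two instances of M that differ in one argument squares the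
    other three arguments, and central maps undo the squaring, so M is closed
    under products in each argument.  Finally M holds as soon as two of its
    arguments coincide, hence on everything generated by three elements. *)

Section Quasigroup.

Variables (Q : Type) (op ld rd : Q -> Q -> Q).

Local Infix "·" := op (at level 40, left associativity).
Local Notation s u := (u · u).

Hypothesis op_ld : forall a b, a · ld a b = b.
Hypothesis ld_op : forall a b, ld a (a · b) = b.
Hypothesis op_rd : forall a b, rd b a · a = b.
Hypothesis rd_op : forall a b, rd (b · a) a = b.

Lemma op_inj_l a x y : a · x = a · y -> x = y.
Proof. intro E. rewrite <- (ld_op a x), <- (ld_op a y), E. reflexivity. Qed.

Lemma op_inj_r a x y : x · a = y · a -> x = y.
Proof. intro E. rewrite <- (rd_op a x), <- (rd_op a y), E. reflexivity. Qed.

Definition shiftR (b c : Q -> Q) : Prop := forall x y, x · b y = c (x · y).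
Definition shiftL (b c : Q -> Q) : Prop := forall x y, b x · y = c (x · y).
Definition central (b : Q -> Q) : Prop := exists c, shiftR b c.

Lemma central_inj b y y' : central b -> b y = b y' -> y = y'.
Proof.
  intros [c Hc] E.
  (* Both [y · b y] and [rd (y · y) y' · b y'] equal [c (y · y)]. *)
  assert (E2 : y = rd (y · y) y').
  { apply (op_inj_r (b y)). rewrite Hc, E, Hc, op_rd. reflexivity. }
  apply (op_inj_l y). rewrite E2 at 3. rewrite op_rd. reflexivity.
Qed.

(** * Nearness and the left semimedial law *)

(* [near p q] says that [L_p^-1 L_q] is central. *)
Definition near (p q : Q) : Prop :=
  exists b, central b /\ forall y, q · y = p · b y.

Hypothesis right_semimedial : forall x y u, (x · y) · s u = (x · u) · (y · u).
Hypothesis cubic_medial :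
  forall w z v, (w · s w) · (z · v) = (w · z) · (s w · v).

Lemma square_op x u : s (x · u) = s x · s u.
Proof. symmetry. apply right_semimedial. Qed.

Lemma near_mul_r p q u : near p q -> near (p · u) (q · u).
Proof.
  intros [b [[c Hc] Hb]].
  exists (fun y => b (rd y u) · u). split.
  - exists (fun t => c (rd t (s u)) · s u). intros x y.
    rewrite <- (op_rd u x), <- (op_rd u y), rd_op.
    rewrite <- !right_semimedial, rd_op, Hc. reflexivity.
  - intro y. rewrite <- (op_rd u y), rd_op.
    rewrite <- !right_semimedial, Hb. reflexivity.
Qed.

Lemma near_cancel_l w p q : near (w · p) (w · q) -> near p q.
Proof.
  intros [b [[c Hc] Hb]].
  exists (fun y => ld (s w) (b (s w · y))). split.
  - exists (fun t => ld (w · s w) (c ((w · s w) · t))). intros x y.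
    apply (op_inj_l (w · s w)).
    rewrite op_ld, !cubic_medial, op_ld, Hc. reflexivity.
  - intro y. apply (op_inj_l (w · s w)).
    rewrite !cubic_medial, op_ld. apply Hb.
Qed.

(* Both [L_(ww)] and [L_r] with [r u = ww.uu] occur as second components of
   autotopisms with first component [L_w]. *)
Lemma near_square_quotient w u : near (s w) (rd (s w · s u) u).
Proof.
  set (r := rd (s w · s u) u).
  exists (fun y => ld (s w) (r · y)). split.
  - exists (fun t => ld (w · s w)
             (rd (((w · u) · s (w · u)) · (t · s u)) (s (s u)))).
    intros x y. apply (op_inj_l (w · s w)).
    rewrite op_ld, cubic_medial, op_ld.
    apply (op_inj_r (s (s u))). rewrite op_rd.
    rewrite (right_semimedial (w · x)), !(right_semimedial _ _ u).
    rewrite cubic_medial, square_op. unfold r. rewrite op_rd. reflexivity.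
  - intro y. rewrite op_ld. reflexivity.
Qed.

Lemma near_square u : near u (s u).
Proof.
  (* The pair [s u · u], [s u · s u] is the previous lemma at [w = u], multiplied by [u] on the
     right. *)
  apply near_cancel_l with (s u).
  pose proof (near_mul_r _ _ u (near_square_quotient u u)) as H.
  rewrite op_rd in H. exact H.
Qed.

Lemma left_semimedial w x y : s w · (x · y) = (w · x) · (w · y).
Proof.
  destruct (near_square w) as [b [[c Hc] Hb]].
  assert (K : forall t, (w · s w) · t = s w · c t).
  { intro t. rewrite <- (op_ld w t) at 1 2.
    rewrite <- Hc, <- Hb, cubic_medial. reflexivity. }
  (* Writing [w · y] as [s w · v] makes [cubic_medial] applicable. *)
  set (v := ld (s w) (w · y)).
  assert (Ev : s w · v = w · y) by apply op_ld.
  assert (Eb : b v = y) by (apply (op_inj_l w); rewrite <- Hb; exact Ev).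
  rewrite <- Ev, <- cubic_medial, K, <- Hc, Eb. reflexivity.
Qed.

(** * Moving central maps across a product *)

(** With [u = x · y], dividing both factors on the left by [u] turns [x · c y] into [s u] times a
    value of [c] that depends on [u] alone. *)
Lemma shiftR_central b c : shiftR b c -> central c.
Proof.
  intro H. exists (fun t => s t · c (ld (s t) t)). intros x y.
  set (u := x · y).
  rewrite <- (op_ld u x), <- (op_ld u y) at 1.
  rewrite <- H, <- left_semimedial, H. f_equal. f_equal.
  apply (op_inj_l (s u)). rewrite left_semimedial, !op_ld. reflexivity.
Qed.

Lemma shiftR_shiftL b c : shiftR b c -> exists d, shiftL c d.
Proof.
  intro H. destruct (shiftR_central _ _ H) as [d Hd].
  pose proof (shiftR_central _ _ H) as Cc.
  pose proof (shiftR_central _ _ Hd) as Cd.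
  (* [c x · y] depends on [x · y] only, since [d (c x · y) = c x · c y] does. *)
  assert (K : forall x y v, d (c x · y) = rd (x · y) (s v) · s (b v)).
  { intros x y v. rewrite <- Hd.
    rewrite <- (op_rd v x), <- (op_rd v y), <- !H.
    rewrite <- !right_semimedial, rd_op. reflexivity. }
  (* As [rd t t · t = t], this is the common value of [c x · y] over all [x · y = t]. *)
  exists (fun t => c (rd t t) · t). intros x y.
  apply (central_inj d _ _ Cd).
  rewrite (K x y x), (K _ _ x), op_rd. reflexivity.
Qed.

Lemma central_shiftL b : central b -> exists c, central c /\ shiftL b c.
Proof.
  intros [c Hc].
  (* Conjugating [b] by a left translation gives a map whose shift is [b], so [b] can stand for [c]
     in the previous lemma. *)
  assert (Hb' : forall u, shiftR (fun y => ld u (b (u · y))) b).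
  { intros u x y. apply (op_inj_l (s u)).
    rewrite left_semimedial, op_ld, Hc, <- left_semimedial.
    symmetry. apply Hc. }
  assert (K : forall x y z t, x · y = z · t -> b x · y = b z · t).
  { intros x y z t E. destruct (shiftR_shiftL _ _ (Hb' x)) as [d Hd].
    rewrite !Hd, E. reflexivity. }
  exists (fun t => b (rd t t) · t). split.
  - exists (fun t => c (rd t (s t)) · s t). intros x y.
    set (u := x · y).
    rewrite (K (rd y y) y (rd y u) u) by (rewrite !op_rd; reflexivity).
    rewrite <- (op_rd u x) at 1.
    rewrite <- right_semimedial, Hc. f_equal. f_equal.
    apply (op_inj_r (s u)).
    rewrite right_semimedial, !op_rd. reflexivity.
  - intros x y. apply K. rewrite op_rd. reflexivity.
Qed.

Lemma central_shiftR b : central b -> exists c, central c /\ shiftR b c.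
Proof.
  intros [c Hc]. exists c. split; [exact (shiftR_central _ _ Hc) | exact Hc].
Qed.

Lemma square_central u : exists z, central z /\ s u = z u.
Proof.
  destruct (near_square u) as [b [[c Hc] Hb]].
  destruct (shiftR_central _ _ Hc) as [d Hd].
  (* This is [c] conjugated by right translation by [u]; [s u · u = u · b u = c (u · u)] gives
     [s u = z u]. *)
  set (z := fun x => rd (c (x · u)) u).
  assert (Cz : central z).
  { exists (fun t => rd (d (t · s u)) (s u)). intros x y.
    apply (op_inj_r (s u)). unfold z.
    rewrite op_rd, !right_semimedial, op_rd. apply Hd. }
  exists z. split; [exact Cz |].
  destruct (central_shiftL _ Cz) as [e [_ He]].
  apply (op_inj_r u). rewrite Hb, Hc. unfold z. rewrite op_rd. reflexivity.
Qed.

(** * The mediality relation on four elements *)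

Definition M (w x y z : Q) : Prop := (w · x) · (y · z) = (w · y) · (x · z).

Lemma M_central_1 b w x y z : central b -> M (b w) x y z <-> M w x y z.
Proof.
  intro Hb. destruct (central_shiftL _ Hb) as [c [Hc Ec]].
  destruct (central_shiftL _ Hc) as [d [Hd Ed]].
  unfold M. rewrite !Ec, !Ed. split; intro E.
  - exact (central_inj _ _ _ Hd E).
  - rewrite E. reflexivity.
Qed.

Lemma M_central_2 b w x y z : central b -> M w (b x) y z <-> M w x y z.
Proof.
  intro Hb.
  destruct (central_shiftR _ Hb) as [c1 [Hc1 Ec1]].
  destruct (central_shiftL _ Hc1) as [d1 [Hd1 Ed1]].
  destruct (central_shiftL _ Hb) as [c2 [Hc2 Ec2]].
  destruct (central_shiftR _ Hc2) as [d2 [Hd2 Ed2]].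
  (* Any [t] has the form [(p · t) · (t · t)], and there [right_semimedial] compares the two
     shifts. *)
  assert (D : forall t, d1 t = d2 t).
  { intro t. rewrite <- (op_rd (s t) t), <- (op_rd t (rd t (s t))).
    rewrite <- Ed1, <- Ec1, !right_semimedial, Ec2, Ed2. reflexivity. }
  unfold M. rewrite Ec1, Ed1, Ec2, Ed2, D. split; intro E.
  - exact (central_inj _ _ _ Hd2 E).
  - rewrite E. reflexivity.
Qed.

Lemma M_sym w x y z : M w x y z <-> M w y x z.
Proof. unfold M. split; intro E; symmetry; exact E. Qed.

Lemma M_central_3 b w x y z : central b -> M w x (b y) z <-> M w x y z.
Proof.
  intro Hb. rewrite M_sym, M_central_2 by exact Hb. apply M_sym.
Qed.

Lemma M_central_4 b w x y z : central b -> M w x y (b z) <-> M w x y z.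
Proof.
  intro Hb. destruct (central_shiftR _ Hb) as [c [Hc Ec]].
  destruct (central_shiftR _ Hc) as [d [Hd Ed]].
  unfold M. rewrite !Ec, !Ed. split; intro E.
  - exact (central_inj _ _ _ Hd E).
  - rewrite E. reflexivity.
Qed.

Lemma M_square_1 w x y z : M (s w) x y z <-> M w x y z.
Proof.
  destruct (square_central w) as [b [Hb ->]]. apply M_central_1, Hb.
Qed.

Lemma M_square_2 w x y z : M w (s x) y z <-> M w x y z.
Proof.
  destruct (square_central x) as [b [Hb ->]]. apply M_central_2, Hb.
Qed.

Lemma M_square_3 w x y z : M w x (s y) z <-> M w x y z.
Proof.
  destruct (square_central y) as [b [Hb ->]]. apply M_central_3, Hb.
Qed.

Lemma M_square_4 w x y z : M w x y (s z) <-> M w x y z.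
Proof.
  destruct (square_central z) as [b [Hb ->]]. apply M_central_4, Hb.
Qed.

Lemma M_op_1 p q x y z : M p x y z -> M q x y z -> M (p · q) x y z.
Proof.
  intros Hp Hq. apply M_square_2, M_square_3, M_square_4. unfold M.
  rewrite <- !square_op, !(right_semimedial p q).
  rewrite !(right_semimedial (p · _)), Hp, Hq. reflexivity.
Qed.

Lemma M_op_3 w x p q z : M w x p z -> M w x q z -> M w x (p · q) z.
Proof.
  intros Hp Hq. apply M_square_1, M_square_2, M_square_4. unfold M.
  rewrite <- !square_op, (right_semimedial p q), (left_semimedial w p q).
  rewrite left_semimedial, right_semimedial, Hp, Hq. reflexivity.
Qed.

Lemma M_op_2 w p q y z : M w p y z -> M w q y z -> M w (p · q) y z.
Proof.
  intros Hp Hq. apply M_sym, M_op_3; apply M_sym; assumption.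
Qed.

(** The instance for [p] cancels from the product of both instances. The converse direction, from
    [p · q] to [q], serves the case of equal outer arguments. *)
Lemma M_op_4 w x y p q : M w x y p -> (M w x y (p · q) <-> M w x y q).
Proof.
  intro Hp. rewrite <- (M_square_1 w), <- M_square_2, <- M_square_3.
  unfold M at 1. rewrite <- !square_op, !(left_semimedial _ p q).
  rewrite !left_semimedial, Hp.
  split; intro E.
  - exact (op_inj_l _ _ _ E).
  - rewrite E. reflexivity.
Qed.

Lemma M_eq_12 w y z : M w w y z.
Proof. apply left_semimedial. Qed.

Lemma M_eq_13 w x z : M w x w z.
Proof. apply M_sym, M_eq_12. Qed.

Lemma M_eq_23 w x z : M w x x z.
Proof. reflexivity. Qed.

Lemma M_eq_34 w x y : M w x y y.
Proof. apply right_semimedial. Qed.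

Lemma M_eq_24 w x y : M w x y x.
Proof. apply M_sym, M_eq_34. Qed.

(* With [y = p w], both [p] and [p w] are admissible last arguments. *)
Lemma M_eq_14 w x y : M w x y w.
Proof.
  rewrite <- (op_rd w y). set (p := rd y w).
  apply (M_op_4 w x (p · w) p w).
  - apply M_op_3; [apply M_eq_34 | apply M_eq_13].
  - apply M_eq_34.
Qed.

Lemma M_generated (S : Ensemble Q) :
  (forall w x y z, In Q S w -> In Q S x -> In Q S y -> In Q S z -> M w x y z) ->
  medial_on op (generated op S).
Proof.
  intros HS w x y z Hw Hx Hy Hz. change (M w x y z).
  revert z Hz y Hy x Hx w Hw.
  (* Arguments pass from generators to generated elements one at a time, from the last to the
     first. *)
  assert (H4 : forall w x y z, In Q S w -> In Q S x -> In Q S y ->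
                 In Q (generated op S) z -> M w x y z).
  { intros w x y z Hw Hx Hy Hz. apply (Hz (fun t => M w x y t)).
    - intros p q Hp Hq. apply (M_op_4 w x y p q Hp), Hq.
    - intros t Ht. apply HS; assumption. }
  assert (H3 : forall w x y z, In Q S w -> In Q S x ->
                 In Q (generated op S) y -> In Q (generated op S) z ->
                 M w x y z).
  { intros w x y z Hw Hx Hy Hz. apply (Hy (fun t => M w x t z)).
    - intros p q Hp Hq. apply M_op_3; assumption.
    - intros t Ht. apply H4; assumption. }
  intros z Hz y Hy x Hx w Hw. apply (Hw (fun t => M t x y z)).
  - intros p q Hp Hq. apply M_op_1; assumption.
  - intros t Ht. apply (Hx (fun r => M t r y z)).
    + intros p q Hp Hq. apply M_op_2; assumption.
    + intros r Hr. apply H3; assumption.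
Qed.

Lemma semimedial_trimedial : trimedial op.
Proof.
  intros a b c. apply M_generated. intros w x y z Hw Hx Hy Hz.
  destruct Hw, Hx, Hy, Hz;
    first [ apply M_eq_12 | apply M_eq_13 | apply M_eq_23
          | apply M_eq_34 | apply M_eq_24 | apply M_eq_14 ].
Qed.

End Quasigroup.

(** * Division operations and the equivalence *)

Lemma quasigroup_divisions (Q : Type) (op : Q -> Q -> Q) :
  quasigroup op ->
  exists ld rd : Q -> Q -> Q,
    (forall a b, op a (ld a b) = b) /\ (forall a b, ld a (op a b) = b) /\
    (forall a b, op (rd b a) a = b) /\ (forall a b, rd (op b a) a = b).
Proof.
  intro hQ.
  pose (l := fun a b => constructive_indefinite_description _ (proj1 (hQ a b))).
  pose (r := fun b a => constructive_indefinite_description _ (proj2 (hQ a b))).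
  exists (fun a b => proj1_sig (l a b)), (fun b a => proj1_sig (r b a)).
  repeat split; intros a b.
  - exact (proj1 (proj2_sig (l a b))).
  - apply (proj2 (proj2_sig (l a (op a b)))). reflexivity.
  - exact (proj1 (proj2_sig (r b a))).
  - apply (proj2 (proj2_sig (r (op b a) a))). reflexivity.
Qed.

Theorem mainTheorem3 (Q : Type) (op : Q -> Q -> Q) (hQ : quasigroup op) :
  trimedial op <->
  (forall x y u w z v : Q,
     op (op (op x y) (op u u)) (op (op w (op w w)) (op z v)) =
     op (op (op x u) (op y u)) (op (op w z) (op (op w w) v))).
Proof.
  destruct (quasigroup_divisions Q op hQ)
    as (ld & rd & op_ld & ld_op & op_rd & rd_op).
  split.
  - intros T x y u w z v.
    assert (G : forall S t, In Q S t -> In Q (generated op S) t).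
    { intros S t Ht H _ HS. apply HS, Ht. }
    f_equal.
    + apply (T x y u); apply G; constructor.
    + apply (T w z v); try (apply G; constructor).
      intros H sub inc. apply sub; apply inc; constructor.
  - intro I.
    assert (cubic : forall w z v,
      op (op w (op w w)) (op z v) = op (op w z) (op (op w w) v)).
    { intros w z v. apply (op_inj_l Q op ld ld_op _ _ _ (I w w w w z v)). }
    apply (semimedial_trimedial Q op ld rd); try assumption.
    (* At [w = z = v = u] the right factors agree by [cubic]. *)
    intros x y u. pose proof (I x y u u u u) as E.
    rewrite cubic in E. apply (op_inj_r Q op rd rd_op _ _ _ E).
Qed.
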